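(* Let $N\ge 2$, $f\ge 1$ an integer, and let $\mathbf w^{\mathrm{start}},\mathbf w^{\mathrm{end}}$ be weight vectors in $\Delta^{N-1}$. Among all $f$-step paths $\mathbf w^{(0)}=\mathbf w^{\mathrm{start}},\mathbf w^{(1)},\dots,\mathbf w^{(f)}=\mathbf w^{\mathrm{end}}$ in $\Delta^{N-1}$, the path minimising the sum of squared Fisher--Rao arc-lengths $$\sum_{k=1}^f(\mathrm ds_k)^2,\qquad \mathrm ds_k=\text{Fisher--Rao geodesic distance between }\mathbf w^{(k-1)}\text{ and }\mathbf w^{(k)},$$ is the constant-speed geodesic, i.e. the SLERP path in Hellinger coordinates: $$w_i^{(k)}=\left[\frac{\sin\left((1-\tfrac kf)\Omega\right)}{\sin\Omega}\sqrt{w_i^{\mathrm{start}}}+\frac{\sin\left(\tfrac kf\Omega\right)}{\sin\Omega}\sqrt{w_i^{\mathrm{end}}}\right]^2,\qquad k=0,\dots,f,$$ where the geodesic angle is $\Omega=\arccos\left(\sum_{i=1}^N\sqrt{w_i^{\mathrm{start}}w_i^{\mathrm{end}}}\right)$.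
   Context: $\Delta^{N-1}=\{\mathbf w\in\mathbb R^N: w_i>0,\ \sum_i w_i=1\}$. The Fisher--Rao metric on $\Delta^{N-1}$ is the Riemannian metric with line element $\mathrm ds^2=\sum_i(\mathrm dw_i)^2/w_i$. Under the Hellinger embedding $\eta_i=\sqrt{w_i}$, $\Delta^{N-1}$ is mapped onto the positive orthant of the unit sphere $S^{N-1}$ and the metric becomes $4\sum_i(\mathrm d\eta_i)^2$, i.e. 4 times the round metric; thus the Fisher--Rao distance between $\mathbf w$ and $\mathbf w'$ is $2\arccos\left(\sum_i\sqrt{w_iw_i'}\right)$. SLERP denotes spherical linear interpolation. When $\mathbf w^{\mathrm{start}}=\mathbf w^{\mathrm{end}}$ ($\Omega=0$) the SLERP path is understood as the constant path. *)

(* Defs.v *)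
From HB Require Import structures.
From mathcomp Require Import all_boot all_order all_algebra.
From mathcomp Require Import all_classical all_reals all_analysis.

Set Implicit Arguments.
Unset Strict Implicit.
Unset Printing Implicit Defensive.

Import Order.TTheory GRing.Theory Num.Theory.
Import numFieldNormedType.Exports.

Local Open Scope classical_set_scope.
Local Open Scope ring_scope.

Definition open_simplex (R : realType) (N : nat) : set 'rV[R]_N :=
  [set w | (forall i, 0 < w 0 i) /\ \sum_i w 0 i = 1].

(* A C^1 curve parametrised by [0, 1] is given by a C^1 function on the whole
   line; every C^1 function on [0, 1], with one-sided derivatives at the ends,
   is the restriction of such a function.  Only the values on [0, 1] are
   required to lie in the simplex. *)
Definition C1_curve (R : realType) (N : nat) (c : R -> 'rV[R]_N) : Prop :=
  [/\ forall i t, derivable (fun s => c s 0 i) t 1,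
      forall i, continuous (derive1 (fun s => c s 0 i))
    & forall t, 0 <= t <= 1 -> open_simplex (c t)].

(* ds/dt for the line element ds^2 = \sum_i (dw_i)^2 / w_i. *)
Definition fr_speed (R : realType) (N : nat) (c : R -> 'rV[R]_N) (t : R) : R :=
  Num.sqrt (\sum_i derive1 (fun s => c s 0 i) t ^+ 2 / c t 0 i).

Definition fr_length (R : realType) (N : nat) (c : R -> 'rV[R]_N) : R :=
  \int[lebesgue_measure]_(t in `[0, 1]) fr_speed c t.

(* For v and w in the simplex the set below is nonempty (it contains the length
   of the straight segment) and bounded below by 0, so inf is a genuine
   infimum. *)
Definition fr_dist (R : realType) (N : nat) (v w : 'rV[R]_N) : R :=
  inf [set fr_length c | c in
         [set c : R -> 'rV[R]_N | [/\ C1_curve c, c 0 = v & c 1 = w]]].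

(* Only the values p 0, ..., p f are relevant. *)
Definition step_path (R : realType) (N f : nat) (v w : 'rV[R]_N)
    (p : nat -> 'rV[R]_N) : Prop :=
  [/\ p 0%N = v, p f = w & forall k, (k <= f)%N -> open_simplex (p k)].

Definition path_energy (R : realType) (N f : nat) (p : nat -> 'rV[R]_N) : R :=
  \sum_(1 <= k < f.+1) fr_dist (p k.-1) (p k) ^+ 2.

Definition energy_minimiser (R : realType) (N f : nat) (v w : 'rV[R]_N)
    (p : nat -> 'rV[R]_N) : Prop :=
  step_path f v w p /\
  forall q, step_path f v w q -> path_energy f p <= path_energy f q.

Definition constant_speed_geodesic (R : realType) (N : nat) (v w : 'rV[R]_N)
    (c : R -> 'rV[R]_N) : Prop :=
  [/\ c 0 = v, c 1 = w,
      forall t, 0 <= t <= 1 -> open_simplex (c t)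
    & forall s t, 0 <= s <= 1 -> 0 <= t <= 1 ->
        fr_dist (c s) (c t) = `|t - s| * fr_dist v w].

Definition geodesic_angle (R : realType) (N : nat) (v w : 'rV[R]_N) : R :=
  acos (\sum_i Num.sqrt (v 0 i * w 0 i)).

(* For v = w the angle is 0 and the quotients by its sine are meaningless; the
   path is then constant. *)
Definition slerp (R : realType) (N : nat) (v w : 'rV[R]_N) (t : R) : 'rV[R]_N :=
  if v == w then v else
  let Omega := geodesic_angle v w in
  \row_i (sin ((1 - t) * Omega) / sin Omega * Num.sqrt (v 0 i)
          + sin (t * Omega) / sin Omega * Num.sqrt (w 0 i)) ^+ 2.

(* Main.v *)
(* Under the Hellinger map w |-> sqrt w the Fisher-Rao distance is 2 Omega(v, w),
   where Omega is the angle between a = sqrt v and b = sqrt w.  The SLERP curve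
   has constant speed 2 Omega, so the distance is at most 2 Omega.  Conversely,
   let e be the unit vector in the plane of a and b orthogonal to a, on the side
   of b.  As a is positive, e is neither plus nor minus the square root of a
   point of the simplex, so asin <e, sqrt (c t)> is C^1 along every admissible
   curve c; it grows from 0 to Omega, and at most at half the Fisher-Rao speed.
   Angles satisfy the triangle inequality, so Cauchy-Schwarz bounds the energy of
   an f-step path below by d(v, w)^2 / f, and forces the steps of a minimiser to
   have equal lengths.  A point x with Omega(v, x) <= t Omega and
   Omega(x, w) <= (1 - t) Omega is the SLERP point at time t. *)

Require Import Defs.
From HB Require Import structures.
From mathcomp Require Import all_boot all_order all_algebra.
From mathcomp Require Import all_classical all_reals all_analysis.
From mathcomp Require Import ring lra.

Set Implicit Arguments.
Unset Strict Implicit.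
Unset Printing Implicit Defensive.

Import Order.TTheory GRing.Theory Num.Theory.
Import numFieldNormedType.Exports.

Local Open Scope ring_scope.

(** * The Cauchy-Schwarz inequality for finite sums *)

Lemma sum_cauchy_schwarz (R : realFieldType) (I : finType) (x y : I -> R) :
  (\sum_i x i * y i) ^+ 2 <= (\sum_i x i ^+ 2) * (\sum_i y i ^+ 2).
Proof.
set C := \sum_i x i * y i; set A := \sum_i x i ^+ 2; set B := \sum_i y i ^+ 2.
have [B0|B0] := eqVneq B 0.
  have y0 i : y i = 0.
    apply/eqP; rewrite -sqrf_eq0; apply/eqP.
    by apply: (psumr_eq0P _ B0) => // j _; exact: sqr_ge0.
  by rewrite B0 mulr0 /C big1 ?expr0n// => i _; rewrite y0 mulr0.
have Bgt0 : 0 < B by rewrite lt_def B0 sumr_ge0// => i _; exact: sqr_ge0.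
(* The vector summed here is [B] times the component of [x] orthogonal to [y]. *)
have : 0 <= \sum_i (B * x i - C * y i) ^+ 2.
  by apply: sumr_ge0 => i _; exact: sqr_ge0.
have -> b c : \sum_i (b * x i - c * y i) ^+ 2 =
    b ^+ 2 * A - 2 * b * c * C + c ^+ 2 * B.
  rewrite /A /B /C !mulr_sumr -sumrB -big_split/=.
  by apply: eq_bigr => i _; ring.
have -> : B ^+ 2 * A - 2 * B * C * C + C ^+ 2 * B = B * (A * B - C ^+ 2) by ring.
by rewrite pmulr_rge0// subr_ge0.
Qed.

(** * Square roots of weight vectors and the angles between them *)

Definition hellinger {R : realType} {N : nat} (v : 'rV[R]_N) (i : 'I_N) : R :=
  Num.sqrt (v 0 i).

(** The Bhattacharyya coefficient, that is, the inner product of two unit vectors of the Hellinger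
    sphere. *)
Definition affinity {R : realType} {N : nat} (v w : 'rV[R]_N) : R :=
  \sum_i hellinger v i * hellinger w i.

Section angle.
Context {R : realType} {N : nat}.
Implicit Types v w x : 'rV[R]_N.

Lemma hellinger_gt0 v i : open_simplex v -> 0 < hellinger v i.
Proof. by move=> [v0 _]; rewrite sqrtr_gt0. Qed.

Lemma sqr_hellinger v i : open_simplex v -> hellinger v i ^+ 2 = v 0 i.
Proof. by move=> [v0 _]; rewrite sqr_sqrtr// ltW. Qed.

Lemma sum_sqr_hellinger v : open_simplex v -> \sum_i hellinger v i ^+ 2 = 1.
Proof.
by move=> sv; under eq_bigr do rewrite sqr_hellinger//; case: sv.
Qed.

Lemma hellinger_inj v w : open_simplex v -> open_simplex w ->
  hellinger v =1 hellinger w -> v = w.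
Proof.
move=> sv sw vw; apply/rowP => i.
by rewrite -!sqr_hellinger// vw.
Qed.

Lemma affinityC v w : affinity v w = affinity w v.
Proof. by apply: eq_bigr => i _; rewrite mulrC. Qed.

Lemma affinityvv v : open_simplex v -> affinity v v = 1.
Proof. by move=> sv; rewrite -(sum_sqr_hellinger sv). Qed.

(** An empty sum is not 1. The index makes the affinity a sum with at least one positive term. *)
Lemma simplex_inhabited v : open_simplex v -> exists i : 'I_N, True.
Proof.
case: N v => [|n] v; last by exists ord0.
by case=> _ /eqP; rewrite big_ord0 eq_sym oner_eq0.
Qed.

Lemma affinity_gt0 v w : open_simplex v -> open_simplex w -> 0 < affinity v w.
Proof.
move=> sv sw; have [i _] := simplex_inhabited sv.
rewrite /affinity (bigD1 i)//= ltr_pwDl//.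
  by rewrite mulr_gt0// hellinger_gt0.
by apply: sumr_ge0 => j _; rewrite mulr_ge0// ltW// hellinger_gt0.
Qed.

(** The squared chord between two points of the unit sphere. Its nonnegativity bounds the affinity
    by 1, and its vanishing gives the equality case. *)
Lemma sum_sqr_sub_hellinger v w : open_simplex v -> open_simplex w ->
  \sum_i (hellinger v i - hellinger w i) ^+ 2 = 2 * (1 - affinity v w).
Proof.
move=> sv sw; transitivity (\sum_i hellinger v i ^+ 2 - 2 * affinity v w
    + \sum_i hellinger w i ^+ 2); last by rewrite !sum_sqr_hellinger//; ring.
rewrite mulr_sumr.
by rewrite -sumrB -big_split/=; apply: eq_bigr => i _; ring.
Qed.

Lemma affinity_le1 v w : open_simplex v -> open_simplex w -> affinity v w <= 1.
Proof.
move=> sv sw; have : 0 <= \sum_i (hellinger v i - hellinger w i) ^+ 2.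
  by apply: sumr_ge0 => i _; exact: sqr_ge0.
by rewrite sum_sqr_sub_hellinger// pmulr_rge0// subr_ge0.
Qed.

Lemma affinity_ge1 v w : open_simplex v -> open_simplex w ->
  1 <= affinity v w -> v = w.
Proof.
move=> sv sw vw1; apply: hellinger_inj => // i.
have vw : affinity v w = 1 by apply/le_anti; rewrite affinity_le1.
have := sum_sqr_sub_hellinger sv sw; rewrite vw subrr mulr0 => s0.
have /(_ (fun j _ => sqr_ge0 _) i isT)/eqP := psumr_eq0P _ s0.
by rewrite sqrf_eq0 subr_eq0 => /eqP.
Qed.

Lemma geodesic_angleE v w : open_simplex v ->
  geodesic_angle v w = acos (affinity v w).
Proof.
by move=> [v0 _]; congr acos; apply: eq_bigr => i _; rewrite sqrtrM// ltW.
Qed.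

Lemma affinity_itv v w : open_simplex v -> open_simplex w ->
  -1 <= affinity v w <= 1.
Proof.
move=> sv sw; rewrite affinity_le1// andbT.
by rewrite (le_trans _ (ltW (affinity_gt0 sv sw)))// lerN10.
Qed.

Lemma cos_geodesic_angle v w : open_simplex v -> open_simplex w ->
  cos (geodesic_angle v w) = affinity v w.
Proof.
by move=> sv sw; rewrite geodesic_angleE// acosK// in_itv/= affinity_itv.
Qed.

Lemma geodesic_angle_ge0 v w : open_simplex v -> open_simplex w ->
  0 <= geodesic_angle v w.
Proof. by move=> sv sw; rewrite geodesic_angleE// acos_ge0// affinity_itv. Qed.

Lemma geodesic_angle_lt_pihalf v w : open_simplex v -> open_simplex w ->
  geodesic_angle v w < pi / 2.
Proof.
move=> sv sw; have O0 := geodesic_angle_ge0 sv sw.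
have Opi : geodesic_angle v w <= pi.
  by rewrite geodesic_angleE// acos_lepi// affinity_itv.
have pi0 := pi_gt0 R.
rewrite -ltr_cos ?in_itv/=; [|lra..].
by rewrite cos_pihalf cos_geodesic_angle// affinity_gt0.
Qed.

(** Cosine is decreasing on [[0, pi]]; comparisons of angles become comparisons of inner
    products. *)
Lemma geodesic_angle_le v w (a : R) : open_simplex v -> open_simplex w ->
  0 <= a <= pi -> (geodesic_angle v w <= a) = (cos a <= affinity v w).
Proof.
move=> sv sw a0; have O0 := geodesic_angle_ge0 sv sw.
have O1 := geodesic_angle_lt_pihalf sv sw; have pi0 := pi_gt0 R.
rewrite !leNgt -ltr_cos ?in_itv//=; last by lra.
by rewrite cos_geodesic_angle.
Qed.

Lemma geodesic_angle0 v : open_simplex v -> geodesic_angle v v = 0.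
Proof. by move=> sv; rewrite geodesic_angleE// affinityvv// acos1. Qed.

Lemma geodesic_angle_gt0 v w : open_simplex v -> open_simplex w -> v != w ->
  0 < geodesic_angle v w.
Proof.
move=> sv sw; apply: contra_neqT; rewrite -leNgt => O0.
by apply: affinity_ge1 => //; rewrite -(cos0 R) -geodesic_angle_le// lexx pi_ge0.
Qed.

Lemma sin_geodesic_angle_gt0 v w : open_simplex v -> open_simplex w -> v != w ->
  0 < sin (geodesic_angle v w).
Proof.
move=> sv sw vw; rewrite sin_gt0_pihalf//.
by rewrite geodesic_angle_gt0// geodesic_angle_lt_pihalf.
Qed.

(** The components of [sqrt v] and [sqrt w] orthogonal to [sqrt x] have norms [sin a] and [sin b],
    and their inner product is [affinity v w - cos a * cos b]. Cauchy-Schwarz bounds it below by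
    [- sin a * sin b], so the affinity is at least [cos (a + b)]. *)
Lemma geodesic_angle_triangle v x w :
  open_simplex v -> open_simplex x -> open_simplex w ->
  geodesic_angle v w <= geodesic_angle v x + geodesic_angle x w.
Proof.
move=> sv sx sw; set a := geodesic_angle v x; set b := geodesic_angle x w.
have := geodesic_angle_ge0 sv sx; have := geodesic_angle_ge0 sx sw.
have := geodesic_angle_lt_pihalf sv sx.
have := geodesic_angle_lt_pihalf sx sw.
rewrite -/a -/b => b1 a1 b0 a0; have pi0 := pi_gt0 R.
rewrite geodesic_angle_le//; last by lra.
have ca : cos a = affinity v x by exact: cos_geodesic_angle.
have cb : cos b = affinity x w by exact: cos_geodesic_angle.
have sa0 : 0 <= sin a by rewrite sin_ge0_pi//; lra.
have sb0 : 0 <= sin b by rewrite sin_ge0_pi//; lra.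
have rej (y : 'rV[R]_N) c : open_simplex y -> cos c = affinity x y ->
    \sum_i (hellinger y i - cos c * hellinger x i) ^+ 2 = sin c ^+ 2.
  move=> sy cE; rewrite sin2cos2.
  transitivity (\sum_i hellinger y i ^+ 2 - 2 * cos c * affinity x y
      + cos c ^+ 2 * \sum_i hellinger x i ^+ 2); last first.
    by rewrite !sum_sqr_hellinger// -cE; ring.
  rewrite !mulr_sumr.
  by rewrite -sumrB -big_split/=; apply: eq_bigr => i _; ring.
have := sum_cauchy_schwarz (fun i => hellinger v i - cos a * hellinger x i)
  (fun i => hellinger w i - cos b * hellinger x i).
rewrite !rej// ?(affinityC x)// -exprMn.
have -> : \sum_i (hellinger v i - cos a * hellinger x i) *
    (hellinger w i - cos b * hellinger x i) = affinity v w - cos a * cos b.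
  transitivity (affinity v w - cos b * affinity v x - cos a * affinity x w
      + cos a * cos b * \sum_i hellinger x i ^+ 2); last first.
    by rewrite sum_sqr_hellinger// -ca -cb; ring.
  rewrite !mulr_sumr -!sumrB -big_split/=.
  by apply: eq_bigr => i _; ring.
rewrite -[leLHS]real_normK ?num_real// ler_pXn2r ?nnegrE ?mulr_ge0//.
(* Only the lower bound on the inner product is kept. *)
move=> /ler_normlP[+ _].
by rewrite cosD; lra.
Qed.

End angle.

(** * The great circle through the square roots of two distinct weight vectors *)

Section great_circle.
Context {R : realType} {N : nat} (v w : 'rV[R]_N).
Hypotheses (sv : open_simplex v) (sw : open_simplex w) (vw : v != w).

Let Omega := geodesic_angle v w.

Let sO : 0 < sin Omega. Proof. exact: sin_geodesic_angle_gt0. Qed.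
Let O0 : 0 < Omega. Proof. exact: geodesic_angle_gt0. Qed.
Let Opi : Omega < pi / 2. Proof. exact: geodesic_angle_lt_pihalf. Qed.

(** The Gram-Schmidt step for [sqrt w] against [sqrt v]: [cos Omega] is their inner product and
    [sin Omega] the norm of the remainder. *)
Definition unit_tangent i :=
  (hellinger w i - cos Omega * hellinger v i) / sin Omega.

(** The SLERP formula before squaring, written in an orthonormal frame, where inner products and
    derivatives are easy. Positivity is read off the form with quotients of sines instead. *)
Definition great_circle t i :=
  cos (t * Omega) * hellinger v i + sin (t * Omega) * unit_tangent i.

Lemma great_circleE t i : great_circle t i =
  sin ((1 - t) * Omega) / sin Omega * hellinger v i +
  sin (t * Omega) / sin Omega * hellinger w i.
Proof.
rewrite mulrBl mul1r sinB /great_circle /unit_tangent.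
by field; rewrite gt_eqF.
Qed.

Lemma slerpE t i : slerp v w t 0 i = great_circle t i ^+ 2.
Proof. by rewrite /slerp (negbTE vw) mxE great_circleE. Qed.

Lemma sum_unit_tangent_hellinger : \sum_i unit_tangent i * hellinger v i = 0.
Proof.
transitivity ((affinity v w - cos Omega * \sum_i hellinger v i ^+ 2)
    / sin Omega).
  rewrite mulr_sumr -sumrB mulr_suml; apply: eq_bigr => i _.
  by rewrite /unit_tangent; ring.
by rewrite sum_sqr_hellinger// cos_geodesic_angle// mulr1 subrr mul0r.
Qed.

Lemma sum_sqr_unit_tangent : \sum_i unit_tangent i ^+ 2 = 1.
Proof.
transitivity ((\sum_i hellinger w i ^+ 2 - 2 * cos Omega * affinity v w
    + cos Omega ^+ 2 * \sum_i hellinger v i ^+ 2) / sin Omega ^+ 2).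
  rewrite !mulr_sumr -sumrB -big_split/= mulr_suml; apply: eq_bigr => i _.
  by rewrite /unit_tangent; field; rewrite gt_eqF.
rewrite !sum_sqr_hellinger// -cos_geodesic_angle// -/Omega sin2cos2.
field; rewrite -sin2cos2 sqrf_eq0 gt_eqF//.
Qed.

(** Orthonormality of the frame leaves the subtraction formula for the cosine. *)
Lemma sum_great_circle s t :
  \sum_i great_circle s i * great_circle t i = cos ((t - s) * Omega).
Proof.
transitivity (cos (s * Omega) * cos (t * Omega) * (\sum_i hellinger v i ^+ 2)
  + (cos (s * Omega) * sin (t * Omega) + sin (s * Omega) * cos (t * Omega))
    * (\sum_i unit_tangent i * hellinger v i)
  + sin (s * Omega) * sin (t * Omega) * \sum_i unit_tangent i ^+ 2).
  rewrite !mulr_sumr -!big_split/=.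
  by apply: eq_bigr => i _; rewrite /great_circle; ring.
rewrite sum_sqr_hellinger// sum_unit_tangent_hellinger sum_sqr_unit_tangent.
by rewrite mulrBl cosB; ring.
Qed.

Lemma great_circle_gt0 t i : 0 <= t <= 1 -> 0 < great_circle t i.
Proof.
move=> /andP[t0 t1]; rewrite great_circleE; have pi0 := pi_gt0 R.
have rO (r : R) : 0 <= r -> r <= 1 -> 0 <= r * Omega < pi.
  move=> r0 r1; rewrite mulr_ge0 ?(ltW O0)//=.
  by rewrite (le_lt_trans (ler_piMl (ltW O0) r1))// (lt_trans Opi)//; lra.
have sp (r : R) : 0 <= r -> r <= 1 -> 0 <= sin (r * Omega).
  move=> r0 r1; have /andP[rO0 /ltW rOpi] := rO r r0 r1.
  by rewrite sin_ge0_pi// rO0.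
have [->|t0'] := eqVneq t 0.
  rewrite subr0 !mul1r mul0r sin0 divff ?gt_eqF// !mul0r mul1r addr0.
  exact: hellinger_gt0.
rewrite ltr_wpDl//.
  rewrite mulr_ge0// ?(ltW (hellinger_gt0 _ _))// divr_ge0 ?(ltW sO)// sp//; lra.
rewrite mulr_gt0// ?hellinger_gt0// divr_gt0// sin_gt0_pi//.
have /andP[_ tOpi] := rO _ t0 t1.
by rewrite tOpi andbT mulr_gt0// lt_def t0'.
Qed.

Lemma hellinger_slerp t i : 0 <= t <= 1 ->
  hellinger (slerp v w t) i = great_circle t i.
Proof.
by move=> t01; rewrite /hellinger slerpE sqrtr_sqr gtr0_norm// great_circle_gt0.
Qed.

(** Pythagoras for the component of the unit tangent orthogonal to [sqrt x]. *)
Lemma sum_sqr_unit_tangent_residual x : open_simplex x ->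
  let y := \sum_i unit_tangent i * hellinger x i in
  \sum_i (unit_tangent i - y * hellinger x i) ^+ 2 = 1 - y ^+ 2.
Proof.
move=> sx y; have -> c : \sum_i (unit_tangent i - c * hellinger x i) ^+ 2 =
    \sum_i unit_tangent i ^+ 2 - 2 * c * y + c ^+ 2 * \sum_i hellinger x i ^+ 2.
  rewrite /y !mulr_sumr -sumrB -big_split/=.
  by apply: eq_bigr => i _; ring.
by rewrite sum_sqr_unit_tangent sum_sqr_hellinger//; ring.
Qed.

Lemma sum_unit_tangent_hellingerr :
  \sum_i unit_tangent i * hellinger w i = sin Omega.
Proof.
transitivity ((\sum_i hellinger w i ^+ 2 - cos Omega * affinity v w)
    / sin Omega).
  rewrite mulr_sumr -sumrB mulr_suml; apply: eq_bigr => i _.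
  by rewrite /unit_tangent; ring.
rewrite sum_sqr_hellinger// -cos_geodesic_angle// -/Omega -expr2 -sin2cos2.
by rewrite expr2 mulfK// gt_eqF.
Qed.

(* If the bound were attained, [sqrt x] would be plus or minus the unit tangent,
   which is orthogonal to [sqrt v]; but two positive vectors are not orthogonal. *)
Lemma unit_tangent_sum_lt1 x : open_simplex x ->
  `|\sum_i unit_tangent i * hellinger x i| < 1.
Proof.
move=> sx; have := sum_sqr_unit_tangent_residual sx; set y := \sum_i _ => /= E.
have : 0 <= 1 - y ^+ 2 by rewrite -E sumr_ge0// => i _; exact: sqr_ge0.
rewrite le_eqVlt => /predU1P[/esym y1|]; last first.
  rewrite subr_gt0 -[X in _ < X](expr1n _ 2) -real_normK ?num_real//.
  by rewrite ltr_pXn2r ?nnegrE.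
have y0 : y != 0.
  by apply/eqP => y0; move/eqP: y1; rewrite y0 expr0n subr0 oner_eq0.
have ux i : unit_tangent i = y * hellinger x i.
  rewrite y1 in E; have /(_ (fun j _ => sqr_ge0 _) i isT)/eqP := psumr_eq0P _ E.
  by rewrite sqrf_eq0 subr_eq0 => /eqP.
have := sum_unit_tangent_hellinger; under eq_bigr do rewrite ux -mulrA.
by rewrite -mulr_sumr => /eqP; rewrite mulf_eq0 (negbTE y0)/= gt_eqF// affinity_gt0.
Qed.

End great_circle.

(** * SLERP points: membership in the simplex, mutual angles, uniqueness *)

Section slerp.
Context {R : realType} {N : nat} (v w : 'rV[R]_N).
Hypotheses (sv : open_simplex v) (sw : open_simplex w).

Lemma slerpvv (x : 'rV[R]_N) t : slerp x x t = x.
Proof. by rewrite /slerp eqxx. Qed.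

Lemma open_simplex_slerp t : 0 <= t <= 1 -> open_simplex (slerp v w t).
Proof.
have [->|vw] := eqVneq v w; first by rewrite slerpvv.
move=> t01; split => [i|]; first by rewrite slerpE// exprn_gt0// great_circle_gt0.
under eq_bigr do rewrite slerpE// expr2.
by rewrite sum_great_circle// subrr mul0r cos0.
Qed.

Lemma slerp0 : slerp v w 0 = v.
Proof.
have [->|vw] := eqVneq v w; first by rewrite slerpvv.
apply/rowP => i; rewrite slerpE// /great_circle mul0r cos0 sin0 mul0r addr0.
by rewrite mul1r sqr_hellinger.
Qed.

Lemma slerp1 : slerp v w 1 = w.
Proof.
have [->|vw] := eqVneq v w; first by rewrite slerpvv.
apply/rowP => i; rewrite slerpE// great_circleE// subrr !mul1r mul0r sin0.
by rewrite divff ?gt_eqF ?sin_geodesic_angle_gt0// !mul0r add0r mul1r sqr_hellinger.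
Qed.

Lemma geodesic_angle_slerp s t : 0 <= s <= 1 -> 0 <= t <= 1 ->
  geodesic_angle (slerp v w s) (slerp v w t) = `|t - s| * geodesic_angle v w.
Proof.
move=> s01 t01; have ss := open_simplex_slerp s01.
have [vw|vw] := eqVneq v w.
  by rewrite -vw !slerpvv geodesic_angle0// mulr0.
rewrite geodesic_angleE// /affinity.
under eq_bigr do rewrite !hellinger_slerp//.
(* Evenness of the cosine brings its argument into [[0, pi]], where [acos] inverts it. *)
rewrite sum_great_circle// -cos_norm normrM.
have O0 := geodesic_angle_ge0 sv sw; have O1 := geodesic_angle_lt_pihalf sv sw.
have st1 : `|t - s| <= 1 by rewrite ler_norml; lra.
have pi0 := pi_gt0 R; have st0 := normr_ge0 (t - s).
rewrite (ger0_norm O0) cosK// in_itv/= mulr_ge0//=.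
by rewrite (le_trans (ler_piMl O0 st1))//; lra.
Qed.

(* The hypotheses bound below the inner product of [sqrt x] with the SLERP point
   by sin (Omega) / sin (Omega) = 1, so these two unit vectors coincide. *)
Lemma slerp_unique t x : open_simplex x -> 0 <= t <= 1 ->
  geodesic_angle v x <= t * geodesic_angle v w ->
  geodesic_angle x w <= (1 - t) * geodesic_angle v w ->
  x = slerp v w t.
Proof.
move=> sx /andP[t0 t1].
have O0 := geodesic_angle_ge0 sv sw; have O1 := geodesic_angle_lt_pihalf sv sw.
have pi0 := pi_gt0 R.
have rO (r : R) : 0 <= r -> r <= 1 -> 0 <= r * geodesic_angle v w <= pi.
  move=> r0 r1; rewrite mulr_ge0//=.
  by rewrite (le_trans (ler_piMl O0 r1))//; lra.
have tO := rO _ t0 t1.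
have uO : 0 <= (1 - t) * geodesic_angle v w <= pi by apply: rO; lra.
have [vw|vw] := eqVneq v w.
  rewrite -vw slerpvv geodesic_angle0// mulr0 => xv _; apply/esym.
  by apply: affinity_ge1 => //; rewrite -(cos0 R) -geodesic_angle_le// lexx pi_ge0.
rewrite !geodesic_angle_le// => vx xw.
have t01 : 0 <= t <= 1 by rewrite t0.
apply: affinity_ge1 => //; first exact: open_simplex_slerp.
have sO := sin_geodesic_angle_gt0 sv sw vw; set O := geodesic_angle v w in sO *.
rewrite /affinity; under eq_bigr do rewrite hellinger_slerp// great_circleE//.
have -> : \sum_i hellinger x i * (sin ((1 - t) * O) / sin O * hellinger v i
    + sin (t * O) / sin O * hellinger w i)
  = (sin ((1 - t) * O) * affinity v x + sin (t * O) * affinity x w) / sin O.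
  by rewrite !mulr_sumr -big_split/= mulr_suml; apply: eq_bigr => i _; ring.
rewrite ler_pdivlMr// mul1r.
have -> : sin O = sin ((1 - t) * O) * cos (t * O) + sin (t * O) * cos ((1 - t) * O).
  by rewrite [sin (t * O) * _]mulrC -sinD; congr sin; ring.
by rewrite lerD// ler_wpM2l// sin_ge0_pi.
Qed.

End slerp.

(** * Continuity and derivatives of finite sums *)

Section calculus.
Context {R : realType}.

Lemma continuous_sumr_at (I : finType) (F : I -> R -> R) (t : R) :
  (forall i, {for t, continuous (F i)}) ->
  {for t, continuous (fun s => \sum_i F i s)}.
Proof.
move=> cF; apply: (@cvg_big _ _ +%R) => [|i _]; last exact: cF.
exact: add_continuous.
Qed.

Lemma is_derive_sumr n (F : 'I_n -> R -> R) (dF : 'I_n -> R) (t : R) :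
  (forall i, is_derive t 1 (F i) (dF i)) ->
  is_derive t 1 (fun s => \sum_i F i s) (\sum_i dF i).
Proof.
move=> FdF; have := is_derive_sum FdF.
rewrite (_ : \sum_(i < n) F i = fun s => \sum_i F i s)//.
by apply/funext => s; rewrite fct_sumE.
Qed.

Lemma is_derive_continuous (F : R -> R) (t d : R) :
  is_derive t 1 F d -> {for t, continuous F}.
Proof. by move=> [dF _]; exact/differentiable_continuous/derivable1_diffP. Qed.

End calculus.

(** * Speed and length of the SLERP curve *)

Section slerp_length.
Context {R : realType} {N : nat} (v w : 'rV[R]_N).
Hypotheses (sv : open_simplex v) (sw : open_simplex w).

Let Omega := geodesic_angle v w.

Definition great_circle_velocity (t : R) i :=
  Omega * (cos (t * Omega) * unit_tangent v w i
           - sin (t * Omega) * hellinger v i).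

Lemma is_derive_great_circle (t : R) i :
  is_derive t 1 (fun s => great_circle v w s i) (great_circle_velocity t i).
Proof.
have dtO : is_derive t 1 ( *%R^~ Omega) Omega.
  have did : is_derive t 1 (@id R) 1 by exact: is_derive_id.
  have dO : is_derive t 1 (@cst R R Omega) 0 by exact: is_derive_cst.
  apply: (is_derive_eq (is_deriveM did dO)).
  by rewrite scaler0 add0r /GRing.scale/= mulr1.
have dcos := is_derive1_comp (g := *%R^~ Omega) (is_derive_cos (t * Omega)) dtO.
have dsin := is_derive1_comp (g := *%R^~ Omega) (is_derive_sin (t * Omega)) dtO.
have dv : is_derive t 1 (@cst R R (hellinger v i)) 0 by exact: is_derive_cst.
have du : is_derive t 1 (@cst R R (unit_tangent v w i)) 0.
  exact: is_derive_cst.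
apply: (is_derive_eq (is_deriveD (is_deriveM dcos dv) (is_deriveM dsin du))).
by rewrite !scaler0 !add0r /GRing.scale/= /great_circle_velocity; ring.
Qed.

(** Each coordinate is the square of [great_circle] at every real time, even where the latter is not
    positive; so the derivative exists on the whole line, as [C1_curve] demands. *)
Lemma is_derive_slerp (t : R) i : v != w ->
  is_derive t 1 (fun s => slerp v w s 0 i)
    (2 * great_circle v w t i * great_circle_velocity t i).
Proof.
move=> vw; rewrite (_ : (fun s => _) = (fun s => great_circle v w s i) ^+ 2).
  by apply: (is_derive_eq (is_deriveX 2 (is_derive_great_circle t i))).
by apply/funext => s; rewrite slerpE// expr2 expr2.
Qed.

(** The velocity is [Omega] times a rotated unit vector of the orthonormal frame. *)
Lemma sum_sqr_great_circle_velocity t : v != w ->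
  \sum_i great_circle_velocity t i ^+ 2 = Omega ^+ 2.
Proof.
move=> vw; transitivity (Omega ^+ 2 * (
  cos (t * Omega) ^+ 2 * (\sum_i unit_tangent v w i ^+ 2)
  - 2 * cos (t * Omega) * sin (t * Omega)
    * (\sum_i unit_tangent v w i * hellinger v i)
  + sin (t * Omega) ^+ 2 * \sum_i hellinger v i ^+ 2)).
  rewrite !mulr_sumr -sumrB -!big_split/= mulr_sumr.
  by apply: eq_bigr => i _; rewrite /great_circle_velocity; ring.
rewrite sum_sqr_hellinger// sum_unit_tangent_hellinger// sum_sqr_unit_tangent//.
by rewrite mulr0 subr0 !mulr1 cos2Dsin2 mulr1.
Qed.

Lemma C1_curve_slerp : C1_curve (slerp v w).
Proof.
split; last by move=> t t01; exact: open_simplex_slerp.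
- move=> i t; have [<-|vw] := eqVneq v w.
    by under eq_fun do rewrite slerpvv; exact: derivable_cst.
  by have [] := is_derive_slerp t i vw.
- move=> i t; have [<-|vw] := eqVneq v w.
    rewrite (_ : derive1 _ = cst 0); first exact: cst_continuous.
    by apply/funext => s; under eq_fun do rewrite slerpvv; exact: derive1_cst.
  rewrite (_ : derive1 _ = fun t =>
    2 * great_circle v w t i * great_circle_velocity t i); last first.
    by apply/funext => s; rewrite derive1E; have [] := is_derive_slerp s i vw.
  have gcc := is_derive_continuous (is_derive_great_circle t i).
  have tO : {for t, continuous (fun s : R => s * Omega)}.
    by apply: continuousM; [exact: cvg_id|exact: cst_continuous].
  have cc : {for t, continuous (fun s : R => cos (s * Omega))}.
    by apply: (continuous_comp tO); exact: continuous_cos.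
  have cs : {for t, continuous (fun s : R => sin (s * Omega))}.
    by apply: (continuous_comp tO); exact: continuous_sin.
  apply: (@continuousM _ _ (fun s => 2 * great_circle v w s i)).
    by apply: continuousM gcc; exact: cst_continuous.
  apply: continuousM; first exact: cst_continuous.
  by apply: continuousB; apply: continuousM => //; exact: cst_continuous.
Qed.

(** Under [w = eta ^+ 2] the line element is 4 times the Euclidean one, so the speed is twice the
    norm of the velocity. Cancelling [eta] needs its positivity, hence the restriction on [t]. *)
Lemma fr_speed_slerp t : 0 <= t <= 1 -> fr_speed (slerp v w) t = 2 * Omega.
Proof.
move=> t01; have [vw|vw] := eqVneq v w.
  rewrite /Omega -vw geodesic_angle0// mulr0 /fr_speed big1 ?sqrtr0// => i _.
  by under eq_fun do rewrite slerpvv; rewrite derive1_cst expr0n mul0r.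
rewrite /fr_speed; transitivity (Num.sqrt ((2 * Omega) ^+ 2)); last first.
  by rewrite sqrtr_sqr ger0_norm// mulr_ge0// geodesic_angle_ge0.
congr Num.sqrt; rewrite exprMn -(sum_sqr_great_circle_velocity t)// mulr_sumr.
apply: eq_bigr => i _; rewrite derive1E.
have [_ ->] := is_derive_slerp t i vw; rewrite slerpE//.
by field; rewrite gt_eqF// great_circle_gt0.
Qed.

Lemma fr_length_slerp : fr_length (slerp v w) = 2 * Omega.
Proof.
rewrite /fr_length (@eq_Rintegral _ _ _ _ _ (cst (2 * Omega))); last first.
  by move=> t; rewrite inE/= in_itv/= => t01; rewrite fr_speed_slerp.
rewrite Rintegral_cst//= lebesgue_measure_itv/= lte_fin ltr01.
by rewrite oppr0 -EFinD addr0/= mulr1.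
Qed.

End slerp_length.

(** * Every admissible curve between distinct points has length at least twice the angle *)

Section length_lower_bound.
Context {R : realType} {N : nat} (v w : 'rV[R]_N) (c : R -> 'rV[R]_N).
Hypotheses (sv : open_simplex v) (sw : open_simplex w) (vw : v != w).
Hypotheses (hc : C1_curve c) (c0 : c 0 = v) (c1 : c 1 = w).

(** With [c'] the derivative of the curve, [n], [dy] and [G] are those of [sqrt c], [y] and [asin y]
    given by the chain rule, in explicit form so that the continuity of [G] can be read off. *)
Let c' i : R -> R := derive1 (fun s => c s 0 i).
Let n i t : R := (2 * hellinger (c t) i)^-1 * c' i t.
Let y t : R := \sum_i unit_tangent v w i * hellinger (c t) i.
Let dy t : R := \sum_i unit_tangent v w i * n i t.
Let G t : R := (Num.sqrt (1 - y t ^+ 2))^-1 * dy t.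

Let sc (t : R) : 0 <= t <= 1 -> open_simplex (c t).
Proof. by case: hc => _ _; exact. Qed.

Let dc (t : R) i : is_derive t 1 (fun s => c s 0 i) (c' i t).
Proof.
by case: hc => dc _ _; apply: DeriveDef => //; rewrite /c' derive1E.
Qed.

Let dh (t : R) i : 0 <= t <= 1 -> is_derive t 1 (fun s => hellinger (c s) i) (n i t).
Proof.
move=> t01; have [c0' _] := sc t01.
exact: is_derive1_comp (is_derive1_sqrt (c0' i)) (dc t i).
Qed.

Let is_derive_y (t : R) : 0 <= t <= 1 -> is_derive t 1 y (dy t).
Proof.
move=> t01; apply: is_derive_sumr => i.
have du : is_derive t 1 (@cst R R (unit_tangent v w i)) 0 by exact: is_derive_cst.
apply: (is_derive_eq (is_deriveM du (dh i t01))).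
by rewrite scaler0 addr0.
Qed.

(** The bound is strict because [asin] is differentiable only in the open interval. *)
Let y_itv (t : R) : 0 <= t <= 1 -> -1 < y t < 1.
Proof. by move=> t01; rewrite -ltr_norml unit_tangent_sum_lt1//; exact: sc. Qed.

Let sqrt_y_gt0 (t : R) : 0 <= t <= 1 -> 0 < 1 - y t ^+ 2.
Proof.
move=> /y_itv/andP[y0 y1].
by rewrite (_ : 1 - _ = (1 - y t) * (1 + y t)); [nra|ring].
Qed.

Let is_derive_asin_y (t : R) : 0 <= t <= 1 -> is_derive t 1 (fun s => asin (y s)) (G t).
Proof.
move=> t01; exact: is_derive1_comp (is_derive1_asin (y_itv t01)) (is_derive_y t01).
Qed.

Let continuous_hellinger (t : R) i : 0 <= t <= 1 ->
  {for t, continuous (fun s => hellinger (c s) i)}.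
Proof. by move=> t01; exact: is_derive_continuous (dh i t01). Qed.

Let continuous_c' (t : R) i : {for t, continuous (c' i)}.
Proof. by case: hc => _ + _; exact. Qed.

Let continuous_G (t : R) : 0 <= t <= 1 -> {for t, continuous G}.
Proof.
move=> t01; apply: continuousM.
  apply: continuousV; first by rewrite gt_eqF// sqrtr_gt0 sqrt_y_gt0.
  apply: (@continuous_comp _ _ _ (fun s => 1 - y s ^+ 2)); last exact: sqrt_continuous.
  apply: continuousB; first exact: cst_continuous.
  have yc := is_derive_continuous (is_derive_y t01).
  exact: (@continuousM _ _ y y).
apply: continuous_sumr_at => i; apply: continuousM; first exact: cst_continuous.
apply: continuousM => //; apply: continuousV.
  by rewrite mulf_neq0// gt_eqF// hellinger_gt0//; exact: sc.
apply: continuousM; first exact: cst_continuous.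
exact: continuous_hellinger.
Qed.

Let continuous_fr_speed (t : R) : 0 <= t <= 1 -> {for t, continuous (fr_speed c)}.
Proof.
move=> t01; apply: (@continuous_comp _ _ _
  (fun s => \sum_i c' i s ^+ 2 / c s 0 i)); last exact: sqrt_continuous.
apply: continuous_sumr_at => i; apply: continuousM.
  exact: (@continuousM _ _ (c' i) (c' i)).
apply: continuousV; first by have [c0' _] := sc t01; rewrite gt_eqF.
exact: is_derive_continuous (dc t i).
Qed.

(** Near an interior time the coordinates sum constantly to 1. *)
Let sum_c' (t : R) : 0 < t < 1 -> \sum_i c' i t = 0.
Proof.
move=> t01; have [_ <-] := is_derive_sumr (fun i => dc t i).
rewrite (@near_eq_derive _ _ _ _ (@cst R R 1)) ?derive_cst//.
have : t \in `]0, 1[ by rewrite in_itv.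
move=> /near_in_itvoo; apply: filterS => s; rewrite in_itv/= => /andP[s0 s1].
by have [] // := @sc s; rewrite (ltW s0) (ltW s1).
Qed.

(** The velocity [n] of [sqrt c] has norm half the Fisher-Rao speed and is tangent to the sphere.
    Hence [dy] is its inner product with the part of the unit tangent orthogonal to [sqrt c], a
    vector of norm [sqrt (1 - y ^+ 2)]; Cauchy-Schwarz and division by this norm give the bound. *)
Let G_le (t : R) : 0 < t < 1 -> G t <= 2^-1 * fr_speed c t.
Proof.
move=> t01; have t01' : 0 <= t <= 1 by case/andP: t01 => /ltW-> /ltW.
have h0 i : hellinger (c t) i != 0 by rewrite gt_eqF// hellinger_gt0//; exact: sc.
have nE : \sum_i n i t ^+ 2 = (2^-1 * fr_speed c t) ^+ 2.
  rewrite exprMn sqr_sqrtr; last first.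
    by apply: sumr_ge0 => i _; rewrite divr_ge0 ?sqr_ge0// ltW//; have [] := sc t01'.
  rewrite mulr_sumr; apply: eq_bigr => i _.
  by rewrite -(sqr_hellinger i (sc t01')) /n -/(c' i t); field.
(* Tangency to the sphere: this is half the derivative of the sum of the coordinates. *)
have hn : \sum_i hellinger (c t) i * n i t = 0.
  transitivity (2^-1 * \sum_i c' i t); last by rewrite sum_c'// mulr0.
  by rewrite mulr_sumr; apply: eq_bigr => i _; rewrite /n; field.
have := sum_cauchy_schwarz (fun i => unit_tangent v w i - y t * hellinger (c t) i)
  (fun i => n i t).
rewrite sum_sqr_unit_tangent_residual//; last exact: sc.
rewrite nE (_ : \sum_i _ = dy t); last first.
  transitivity (dy t - y t * \sum_i hellinger (c t) i * n i t).
    by rewrite /dy mulr_sumr -sumrB; apply: eq_bigr => i _; ring.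
  by rewrite hn mulr0 subr0.
have s0 := sqrt_y_gt0 t01'; rewrite -(sqr_sqrtr (ltW s0)) -exprMn => dyle.
rewrite /G mulrC ler_pdivrMr ?sqrtr_gt0//.
rewrite (le_trans (ler_norm _))// -ler_sqr ?nnegrE; last 2 first.
- by [].
- by rewrite !mulr_ge0// sqrtr_ge0.
by rewrite real_normK ?num_real// [X in _ <= X ^+ 2]mulrC.
Qed.

(** The integral of [G] is the increase of [asin y], from 0 at [v] to [asin (sin Omega)] at [w],
    which is [Omega] because [Omega] is below [pi / 2]. Integrating [G_le] compares it with half the
    length. *)
Lemma geodesic_angle_le_fr_length_neq : 2 * geodesic_angle v w <= fr_length c.
Proof.
have integrable_itv (f : R -> R) :
    (forall t, 0 <= t <= 1 -> {for t, continuous f}) ->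
    lebesgue_measure.-integrable `[0%R, 1%R] (EFin \o f).
  move=> cf; apply: continuous_compact_integrable; first exact: segment_compact.
  by apply: continuous_in_subspaceT => t; rewrite inE/= in_itv/=; exact: cf.
have integrable_oo (f : R -> R) :
    (forall t, 0 <= t <= 1 -> {for t, continuous f}) ->
    lebesgue_measure.-integrable `]0%R, 1%R[ (EFin \o f).
  move=> cf; apply: (integrableS _ _ _ (integrable_itv f cf)) => //.
  exact: subset_itv_oo_cc.
(* Outside [0, 1] the curve may leave the simplex, so the derivative of
   [\sum_i c s 0 i] is seen to vanish, hence [G_le] to hold, only inside. *)
have Rintegral_oo (f : R -> R) :
    (forall t, 0 <= t <= 1 -> {for t, continuous f}) ->
    \int[lebesgue_measure]_(t in `[0%R, 1%R]) f t =
    \int[lebesgue_measure]_(t in `]0%R, 1%R[) f t.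
  move=> cf; rewrite -Rintegral_itv_bndo_bndc; last first.
    apply: (integrableS _ _ _ (integrable_itv f cf)) => //.
    by apply: subset_itvl; rewrite bnd_simp.
  by rewrite -Rintegral_itv_obnd_cbnd//; exact: integrable_oo.
have FTC : \int[lebesgue_measure]_(t in `[0%R, 1%R]) G t = asin (y 1) - asin (y 0).
  rewrite /Rintegral (@continuous_FTC2 _ _ (fun s => asin (y s)))//.
  - apply: continuous_in_subspaceT => t; rewrite inE/= in_itv/=; exact: continuous_G.
  - split.
    + move=> t; rewrite in_itv/= => /andP[/ltW t0 /ltW t1].
      by have [] // := @is_derive_asin_y t; rewrite t0.
    + apply: cvg_at_right_filter.
      by apply: is_derive_continuous; apply: is_derive_asin_y; rewrite lexx ler01.
    + apply: cvg_at_left_filter.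
      by apply: is_derive_continuous; apply: is_derive_asin_y; rewrite lexx ler01.
  - move=> t; rewrite in_itv/= => /andP[/ltW t0 /ltW t1]; rewrite derive1E.
    by have [] // := @is_derive_asin_y t; rewrite t0.
have y0 : y 0 = 0 by rewrite /y c0 sum_unit_tangent_hellinger.
have y1 : y 1 = sin (geodesic_angle v w).
  by rewrite /y c1 sum_unit_tangent_hellingerr.
have asinO : asin (sin (geodesic_angle v w)) = geodesic_angle v w.
  have := geodesic_angle_ge0 sv sw; have := geodesic_angle_lt_pihalf sv sw.
  by move=> O1 O0; rewrite sinK// in_itv/=; lra.
have asin0 : asin (0 : R) = 0.
  by rewrite -{1}(sin0 R) sinK// in_itv/= oppr_le0 divr_ge0 ?pi_ge0.
rewrite y0 y1 asinO asin0 subr0 in FTC.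
rewrite -FTC -ler_pdivlMl// Rintegral_oo; last exact: continuous_G.
rewrite /fr_length Rintegral_oo; last exact: continuous_fr_speed.
rewrite -RintegralZl//; last by apply: integrable_oo; exact: continuous_fr_speed.
apply: le_Rintegral; [by []| | |exact: G_le].
- by apply: integrable_oo; exact: continuous_G.
- apply: integrable_oo => t t01; apply: continuousM; first exact: cst_continuous.
  exact: continuous_fr_speed.
Qed.

End length_lower_bound.

(** * The Fisher-Rao distance and its constant-speed geodesics *)

Section fr_dist.
Context {R : realType} {N : nat}.
Implicit Types v w x : 'rV[R]_N.

Lemma geodesic_angle_le_fr_length v w (c : R -> 'rV[R]_N) :
  open_simplex v -> open_simplex w -> C1_curve c -> c 0 = v -> c 1 = w ->
  2 * geodesic_angle v w <= fr_length c.
Proof.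
move=> sv sw hc c0 c1; have [vw|vw] := eqVneq v w.
  rewrite -vw geodesic_angle0// mulr0.
  by apply: Rintegral_ge0 => t _; exact: sqrtr_ge0.
exact: geodesic_angle_le_fr_length_neq.
Qed.

(** The SLERP curve is admissible of length [2 * Omega]. It bounds the infimum above and also shows
    the set nonempty, without which [inf] would not inherit the lower bound. *)
Lemma fr_distE v w : open_simplex v -> open_simplex w ->
  fr_dist v w = 2 * geodesic_angle v w.
Proof.
move=> sv sw; apply/le_anti/andP; split.
  rewrite -(fr_length_slerp sv sw); apply: ge_inf.
    by exists 0 => _ [c _ <-]; apply: Rintegral_ge0 => t _; exact: sqrtr_ge0.
  exists (slerp v w) => //.
  by split; [exact: C1_curve_slerp|exact: slerp0|exact: slerp1].
apply: lb_le_inf.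
  exists (fr_length (slerp v w)), (slerp v w) => //.
  by split; [exact: C1_curve_slerp|exact: slerp0|exact: slerp1].
by move=> _ [c [hc c0 c1] <-]; exact: geodesic_angle_le_fr_length.
Qed.

(** The distances from [c t] to the two ends alone determine [c t], by [slerp_unique]. *)
Lemma constant_speed_geodesicP v w (c : R -> 'rV[R]_N) :
  open_simplex v -> open_simplex w ->
  constant_speed_geodesic v w c <->
  (forall t, 0 <= t <= 1 -> c t = slerp v w t).
Proof.
move=> sv sw; have i0 : (0 : R) <= (0 : R) <= 1 by rewrite lexx ler01.
have i1 : (0 : R) <= (1 : R) <= 1 by rewrite lexx ler01.
split=> [[c0 c1 sc dc] t t01|cE].
  have /andP[t0 t1] := t01; have sct := sc t t01.
  have := dc 0 t i0 t01; have := dc t 1 t01 i1.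
  rewrite c0 c1 !fr_distE// subr0 !ger0_norm ?subr_ge0// => d1 d0.
  by apply: slerp_unique => //; lra.
split=> [|||s t s01 t01].
- by rewrite cE ?slerp0.
- by rewrite cE ?slerp1.
- by move=> t t01; rewrite cE//; exact: open_simplex_slerp.
rewrite !cE// !fr_distE//; [|exact: open_simplex_slerp..].
by rewrite geodesic_angle_slerp//; ring.
Qed.

End fr_dist.

(** * Energy of step paths and its minimisers *)

Section energy.
Context {R : realType} {N : nat}.

(** Expand the squares and use that the sum of the [d k] is at least [D]. Keeping the squared
    deviations yields both the energy bound and, when it is attained, [d k = D / f] for every
    step. *)
Lemma sum_sqr_sub_mean_le (f : nat) (d : nat -> R) (D : R) : (0 < f)%N ->
  0 <= D <= \sum_(1 <= k < f.+1) d k ->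
  \sum_(1 <= k < f.+1) (d k - D / f%:R) ^+ 2 <=
  \sum_(1 <= k < f.+1) d k ^+ 2 - D ^+ 2 / f%:R.
Proof.
move=> f0 /andP[D0 Dd]; have fR0 : (f%:R : R) != 0 by rewrite pnatr_eq0 -lt0n.
have -> : \sum_(1 <= k < f.+1) (d k - D / f%:R) ^+ 2 =
    \sum_(1 <= k < f.+1) d k ^+ 2 - 2 * (D / f%:R) * \sum_(1 <= k < f.+1) d k
    + \sum_(1 <= k < f.+1) (D / f%:R) ^+ 2.
  by rewrite mulr_sumr -sumrB -big_split/=; apply: eq_bigr => k _; ring.
have -> : \sum_(1 <= k < f.+1) (D / f%:R) ^+ 2 = D / f%:R * D.
  by rewrite sumr_const_nat subn1/= -mulr_natl; field.
rewrite -addrA lerD2l.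
have : 0 <= D / f%:R * (\sum_(1 <= k < f.+1) d k - D).
  by rewrite mulr_ge0 ?subr_ge0// divr_ge0.
by rewrite expr2 [D * D / _]mulrAC; lra.
Qed.

(** Stated for arbitrary subpaths, since uniqueness applies it on both sides of an intermediate
    point. *)
Lemma geodesic_angle_path (p : nat -> 'rV[R]_N) (f i j : nat) :
  (forall k, (k <= f)%N -> open_simplex (p k)) -> (i <= j <= f)%N ->
  geodesic_angle (p i) (p j) <=
  \sum_(i.+1 <= k < j.+1) geodesic_angle (p k.-1) (p k).
Proof.
move=> sp /andP[]; elim: j => [|j IH].
  by rewrite leqn0 => /eqP -> f0; rewrite big_geq// (geodesic_angle0 (sp _ f0)).
rewrite leq_eqVlt => /predU1P[-> jf|].
  by rewrite big_geq// (geodesic_angle0 (sp _ jf)).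
rewrite ltnS => ij jf.
rewrite big_nat_recr//= (le_trans (geodesic_angle_triangle (x := p j) _ _ _))//.
- by apply: sp; rewrite (leq_trans ij)// ltnW.
- by apply: sp; exact: ltnW.
- exact: sp.
- by rewrite lerD2r IH// ltnW.
Qed.

Variables (f : nat) (v w : 'rV[R]_N).
Hypotheses (f0 : (0 < f)%N) (sv : open_simplex v) (sw : open_simplex w).

Let D := fr_dist v w.

Let f_gt0 : 0 < f%:R :> R. Proof. by rewrite ltr0n. Qed.

Let D_ge0 : 0 <= D.
Proof. by rewrite /D fr_distE// mulr_ge0// geodesic_angle_ge0. Qed.

Let frac_itv k : (k <= f)%N -> 0 <= (k%:R / f%:R : R) <= 1.
Proof.
by move=> kf; rewrite divr_ge0// ler_pdivrMr// mul1r ler_nat.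
Qed.

Lemma sum_sqr_sub_step_le (p : nat -> 'rV[R]_N) : step_path f v w p ->
  \sum_(1 <= k < f.+1) (fr_dist (p k.-1) (p k) - D / f%:R) ^+ 2 <=
  path_energy f p - D ^+ 2 / f%:R.
Proof.
move=> [p0 pf sp]; apply: sum_sqr_sub_mean_le; rewrite // D_ge0/= /D fr_distE//.
have := @geodesic_angle_path p f 0 f sp; rewrite p0 pf leqnn => /(_ isT) a_le.
rewrite (le_trans (ler_wpM2l (ler0n _ 2) a_le))// mulr_sumr.
apply: ler_sum_nat => k /andP[_ kf].
by rewrite fr_distE//; apply: sp => //; rewrite (leq_trans (leq_pred _)).
Qed.

Lemma path_energy_ge (p : nat -> 'rV[R]_N) : step_path f v w p ->
  D ^+ 2 / f%:R <= path_energy f p.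
Proof.
move=> /sum_sqr_sub_step_le; rewrite -(subr_ge0 (D ^+ 2 / _)); apply: le_trans.
by apply: sumr_ge0 => k _; exact: sqr_ge0.
Qed.

Lemma step_path_slerp (p : nat -> 'rV[R]_N) :
  (forall k, (k <= f)%N -> p k = slerp v w (k%:R / f%:R)) -> step_path f v w p.
Proof.
move=> pE; split=> [||k kf]; rewrite pE//.
- by rewrite mul0r slerp0.
- by rewrite divff ?gt_eqF// slerp1.
- by apply: open_simplex_slerp => //; exact: frac_itv.
Qed.

Lemma path_energy_slerp (p : nat -> 'rV[R]_N) :
  (forall k, (k <= f)%N -> p k = slerp v w (k%:R / f%:R)) ->
  path_energy f p = D ^+ 2 / f%:R.
Proof.
move=> pE; rewrite /path_energy (eq_big_nat _ _ (F2 := fun=> (D / f%:R) ^+ 2)).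
  rewrite sumr_const_nat subn1/= -mulr_natl; field; exact: lt0r_neq0.
(* The range starts at 1, so the index is a successor and [k.-1] is a true predecessor. *)
case=> // k /andP[_]; rewrite /= ltnS => kf; congr (_ ^+ 2).
have kf' := ltnW kf; rewrite !pE// fr_distE;
  [|by apply: open_simplex_slerp => //; exact: frac_itv..].
rewrite geodesic_angle_slerp ?frac_itv// -mulrBl -natrB// subSnn.
rewrite ger0_norm ?divr_ge0// /D fr_distE//; ring.
Qed.

(** The deviations vanish, so every step has angle [Omega / f]. Adding the steps before and after
    [p k] bounds its angles to the ends by [k / f] and [1 - k / f] times [Omega], and [slerp_unique]
    applies. *)
Lemma slerp_of_path_energy_le (p : nat -> 'rV[R]_N) : step_path f v w p ->
  path_energy f p <= D ^+ 2 / f%:R ->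
  forall k, (k <= f)%N -> p k = slerp v w (k%:R / f%:R).
Proof.
move=> sp Ep; have [p0 pf sp'] := sp.
have step j : (0 < j <= f)%N ->
    geodesic_angle (p j.-1) (p j) = geodesic_angle v w / f%:R.
  move=> /andP[j0 jf].
  have dj : fr_dist (p j.-1) (p j) = D / f%:R.
    have S0 : \sum_(1 <= k < f.+1) (fr_dist (p k.-1) (p k) - D / f%:R) ^+ 2 = 0.
      apply/le_anti; rewrite sumr_ge0 ?andbT; last by move=> k _; exact: sqr_ge0.
      by rewrite (le_trans (sum_sqr_sub_step_le sp))// subr_le0.
    apply/eqP; rewrite -subr_eq0 -sqrf_eq0; apply/eqP.
    have := S0; rewrite (big_rem j) ?mem_index_iota ?j0//= => /eqP.
    rewrite paddr_eq0 ?sqr_ge0//; first by case/andP => /eqP.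
    by apply: sumr_ge0 => k _; exact: sqr_ge0.
  move: dj; rewrite /D !fr_distE//; last 2 first.
  - by apply: sp'; rewrite (leq_trans (leq_pred _)).
  - exact: sp'.
  by rewrite -mulrA; lra.
have angle_le i j : (i <= j <= f)%N ->
    geodesic_angle (p i) (p j) <= (j - i)%:R / f%:R * geodesic_angle v w.
  move=> /andP[ij jf].
  rewrite (le_trans (@geodesic_angle_path p f i j sp' _)) ?ij//.
  rewrite (eq_big_nat _ _ (F2 := fun=> geodesic_angle v w / f%:R)).
    by rewrite sumr_const_nat subSS -[leLHS]mulr_natl mulrAC mulrA.
  by move=> k /andP[ik kj]; rewrite step// (leq_ltn_trans _ ik)//= (leq_trans _ jf).
move=> k kf; apply: slerp_unique => //; [exact: sp'|exact: frac_itv| |].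
- by have := angle_le 0%N k kf; rewrite p0 subn0.
- have <- : (f - k)%:R / f%:R = 1 - k%:R / f%:R :> R.
    by rewrite natrB// mulrBl divff// gt_eqF.
  by have := angle_le k f; rewrite pf kf leqnn; exact.
Qed.

Lemma energy_minimiserP (p : nat -> 'rV[R]_N) :
  energy_minimiser f v w p <->
  (forall k, (k <= f)%N -> p k = slerp v w (k%:R / f%:R)).
Proof.
split=> [[sp pmin]|pE].
  (* The SLERP path as competitor brings the energy of a minimiser down to [D ^+ 2 / f]. *)
  pose q k := slerp v w (k%:R / f%:R).
  apply: slerp_of_path_energy_le => //; rewrite -(path_energy_slerp (p := q))//.
  by apply: pmin; exact: step_path_slerp.
split; first exact: step_path_slerp.
by move=> q sq; rewrite (path_energy_slerp pE); exact: path_energy_ge.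
Qed.

End energy.

Theorem corollary2 (R : realType) (N f : nat) (hN : (2 <= N)%N) (hf : (1 <= f)%N)
    (wstart wend : 'rV[R]_N)
    (hstart : open_simplex wstart) (hend : open_simplex wend) :
  (forall p : nat -> 'rV[R]_N,
     energy_minimiser f wstart wend p <->
     (forall k : nat, (k <= f)%N -> p k = slerp wstart wend (k%:R / f%:R))) /\
  (forall c : R -> 'rV[R]_N,
     constant_speed_geodesic wstart wend c <->
     (forall t : R, 0 <= t <= 1 -> c t = slerp wstart wend t)).
Proof.
by split=> [p|c]; [exact: energy_minimiserP|exact: constant_speed_geodesicP].
Qed.
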